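(* There exists a language stable, positive entropy, minimal subshift. Moreover, given a sequence of intervals of consecutive integers $$\{i_1,i_1+1,\dots,i_1+j_1\},\ \{i_2,i_2+1,\dots,i_2+j_2\},\ \dots,\ \{i_n,i_n+1,\dots,i_n+j_n\},\ \dots$$ such that both sequences $(i_\ell)$ and $(j_\ell)$ are increasing, there exists a language stable, positive entropy, minimal subshift $X$ which has the property that $X_{i_n}=X_{i_n+j_n}$ for infinitely many $n$, where $X_k$ denotes the $k$-th term in the SFT cover of $X$. Furthermore, if $\alpha\in\mathbb{R}\setminus\mathbb{Q}$, $\beta_1,\beta_2,\beta_3,\ldots\in(0,1)$, and $Z_i$ is the coding of the circle rotation $([0,1),R_\alpha)$ with respect to the partition $\{[0,\beta_i),[\beta_i,1)\}$, then for each $i\in\mathbb{N}$ the shift $X\times Z_i$ is also minimal.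
   Context: A subshift is a closed subset $X\subseteq\mathcal{A}^{\mathbb{Z}}$ ($\mathcal{A}$ finite) invariant under the left shift $(\sigma x)_i=x_{i+1}$; it is minimal if it has no nonempty proper subshift. Positive entropy means positive topological entropy. Products of subshifts carry the product shift. The language $\mathcal{L}(X)$ is the set of finite words occurring as a block of consecutive symbols in some element of $X$. A minimal forbidden word of $X$ is a finite word $w\notin\mathcal{L}(X)$ all of whose proper subwords lie in $\mathcal{L}(X)$; $\mathcal{M}_n(X)$ is the set of those of length $n$. The SFT cover of $X$ is the sequence $(X_k)_{k\ge1}$ where $X_k$ is the set of all $x\in\mathcal{A}^{\mathbb{Z}}$ in which no word of $\bigcup_{m=1}^k\mathcal{M}_m(X)$ occurs. The upper Banach density of $S\subseteq\mathbb{N}$ is $d^*(S)=\limsup_{n\to\infty}\max_k |S\cap\{k,\dots,k+n-1\}|/n$; $X$ is language stable if $\{n\in\mathbb{N}\colon\mathcal{M}_n(X)=\emptyset\}$ has upper Banach density $1$. $R_\alpha(x)=x+\alpha\pmod 1$ on $[0,1)$. The coding of $([0,1),R_\alpha)$ with respect to $\{[0,\beta),[\beta,1)\}$ is the closure in $\{0,1\}^{\mathbb{Z}}$ of the set of sequences $(x_j)_{j\in\mathbb{Z}}$, one for each $x\in[0,1)$, with $x_j=0$ if $R_\alpha^j x\in[0,\beta)$ and $x_j=1$ otherwise. *)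

(* Defs.v *)
From mathcomp Require Import all_boot all_order all_algebra.
From mathcomp Require Import all_classical all_reals all_analysis.

Set Implicit Arguments.
Unset Strict Implicit.
Unset Printing Implicit Defensive.

Import Order.TTheory GRing.Theory Num.Theory.

Local Open Scope classical_set_scope.
Local Open Scope ring_scope.

(* A subsystem of (T, f) is a closed set X with f(X) = X. For f the left shift
   this is a subshift, for a product of shifts a product subsystem. *)
Section Dynamics.
Variables (T : topologicalType) (f : T -> T).

Definition subsystem (X : set T) : Prop := closed X /\ f @` X = X.

Definition minimal (X : set T) : Prop :=
  subsystem X /\ forall Y : set T, subsystem Y -> Y `<` X -> Y = set0.

End Dynamics.

Definition fullshift (A : finType) : topologicalType :=
  prod_topology (fun _ : int => discrete_topology A).

Definition left_shift (A : finType) (x : fullshift A) : fullshift A :=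
  fun i : int => x (i + 1).

Definition subshift (A : finType) (X : set (fullshift A)) : Prop :=
  subsystem (@left_shift A) X.

Definition prod_shift (A B : finType) (p : fullshift A * fullshift B) :
    fullshift A * fullshift B :=
  (left_shift p.1, left_shift p.2).

Section Words.
Variable A : finType.
Implicit Types (w u : seq A) (x : fullshift A) (X : set (fullshift A)).

Definition block x (k : int) (n : nat) : seq A :=
  [seq x (k + m%:Z) | m <- iota 0 n].

Definition occurs w x : Prop := exists k : int, block x k (size w) = w.

Definition language X : set (seq A) := [set w | exists2 x, X x & occurs w x].

Definition min_forbidden X (n : nat) : set (seq A) :=
  [set w | [/\ size w = n, ~ language X w &
            forall u, infix u w -> u != w -> language X u]].

Definition sft_cover X (k : nat) : set (fullshift A) :=
  [set x | forall (m : nat) w, (1 <= m <= k)%N -> min_forbidden X m w ->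
           ~ occurs w x].

Definition complexity X (n : nat) : nat :=
  #|[set t : n.-tuple A | `[< language X t >]]%SET|.

End Words.

Section Quantities.
Variable R : realType.

(* Exponential growth rate of the number of words of length n; for a subshift
   the limsup is a limit, by subadditivity of ln (complexity X n). *)
Definition topological_entropy (A : finType) (X : set (fullshift A)) : \bar R :=
  limn_esup (fun n => (ln ((complexity X n)%:R : R) / n%:R)%:E).

Definition upper_banach_density (S : set nat) : \bar R :=
  limn_esup (fun n => ereal_sup
    (range (fun k => ((count (fun m => `[< S m >]) (iota k n))%:R / n%:R)%:E))).

Definition language_stable (A : finType) (X : set (fullshift A)) : Prop :=
  upper_banach_density [set n | min_forbidden X n = set0] = 1%E.

Definition rotation (alpha x : R) : R :=
  x + alpha - (Num.floor (x + alpha))%:~R.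

(* Integer iterates; on [0, 1) the inverse of rotation alpha is
   rotation (- alpha). *)
Definition rotation_iter (alpha : R) (j : int) (x : R) : R :=
  match j with
  | Posz n => iter n (rotation alpha) x
  | Negz n => iter n.+1 (rotation (- alpha)) x
  end.

(* The symbols 0 and 1 are false and true. *)
Definition itinerary (alpha beta x : R) : fullshift bool :=
  fun j : int => rotation_iter alpha j x \notin `[0, beta[.

Definition rotation_coding (alpha beta : R) : set (fullshift bool) :=
  closure (itinerary alpha beta @` `[0, 1[).

End Quantities.

(* Main.v *)
Require Import Defs.
From mathcomp Require Import all_boot all_order all_algebra.
From mathcomp Require Import all_classical all_reals all_analysis.
From mathcomp Require Import zify lra ring.

Set Implicit Arguments.
Unset Strict Implicit.
Unset Printing Implicit Defensive.

Import Order.TTheory GRing.Theory Num.Theory.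

Local Open Scope classical_set_scope.
Local Open Scope ring_scope.

(* X is a decreasing intersection of topologically mixing shifts of finite
   type, described by their languages. Given such a language L and a length N,
   choose a word P of L which contains every word u of L of length at most N,
   even along two arithmetic progressions with consecutive differences d and
   d + 1, and require P to occur in each window of a large length S. The result
   is again mixing and of finite type, has the same words of length at most N,
   and loses as little entropy as desired when S is large. If L is a K-step
   shift, then no minimal forbidden word of X has length between K + 2 and N,
   so taking K < i_n and N = i_n + j_n at each stage makes the SFT cover
   constant on infinitely many of the given intervals. The words P make X
   minimal. Finally, for alpha irrational, either the multiples of d alpha or
   those of (d + 1) alpha become dense on the circle within a time independent
   of d, so the visits of a point of X to a cylinder meet those of a rotation
   orbit to an arc; X thus does not depend on alpha. *)

(** * Occurrences of words, and mixing languages of finite type *)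

Section WordLanguages.
Local Open Scope nat_scope.

Definition occurs_at (u : seq bool) (j : nat) (v : seq bool) : Prop :=
  exists a b, v = a ++ u ++ b /\ size a = j.

Section OccursAt.
Implicit Types u v w : seq bool.

Lemma occurs_at_size u j v : occurs_at u j v -> j + size u <= size v.
Proof. by move=> [a [b [-> <-]]]; rewrite !size_cat; lia. Qed.

Lemma occurs_at_refl u : occurs_at u 0 u.
Proof. by exists [::], [::]; rewrite cats0. Qed.

Lemma occurs_at_catr u j v w : occurs_at u j v -> occurs_at u j (v ++ w).
Proof. by move=> [a [b [-> <-]]]; exists a, (b ++ w); rewrite !catA. Qed.

Lemma occurs_at_catl u j v w :
  occurs_at u j v -> occurs_at u (size w + j) (w ++ v).
Proof.
by move=> [a [b [-> <-]]]; exists (w ++ a), b; rewrite !catA size_cat.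
Qed.

Lemma occurs_at_catrI u j v w :
  occurs_at u j (v ++ w) -> j + size u <= size v -> occurs_at u j v.
Proof.
move=> [a [b [E <-]]] le_v; exists a, (take (size v - size (a ++ u)) b).
split=> //; rewrite -[LHS](take_size_cat w (erefl (size v))) E !catA take_cat.
by rewrite size_cat ltnNge le_v.
Qed.

Lemma occurs_at_catlI u j v w :
  occurs_at u j (w ++ v) -> size w <= j -> occurs_at u (j - size w) v.
Proof.
move=> [a [b [E <-]]] le_w; exists (drop (size w) a), b.
split; last by rewrite size_drop.
rewrite -[LHS](drop_size_cat v (erefl (size w))) E drop_cat.
case: ltnP => // ge_w; have -> : size w = size a by lia.
by rewrite subnn drop0 drop_size.
Qed.

End OccursAt.

Definition progression (u : seq bool) (d T : nat) (v : seq bool) : Prop :=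
  exists p, forall t, t <= T -> occurs_at u (p + t * d) v.

(** The difference [d] depends on the gluing constant of the language at hand and cannot be
    prescribed, whereas [T] can. The estimate for rotations must therefore be uniform in [d]. *)
Definition twin_progressions (u : seq bool) (T : nat) (v : seq bool) : Prop :=
  exists d, progression u d T v /\ progression u d.+1 T v.

Lemma progression_catl u d T v w :
  progression u d T v -> progression u d T (w ++ v).
Proof.
move=> [p up]; exists (size w + p) => t /up; rewrite -addnA.
exact: occurs_at_catl.
Qed.

Lemma progression_catr u d T v w :
  progression u d T v -> progression u d T (v ++ w).
Proof. by move=> [p up]; exists p => t /up; exact: occurs_at_catr. Qed.

Lemma twin_progressions_infix u T v j w :
  occurs_at v j w -> twin_progressions u T v -> twin_progressions u T w.
Proof.
move=> [a [b [-> _]]] [d [h1 h2]]; exists d.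
by split; apply/progression_catl/progression_catr.
Qed.

(** All gap lengths from [g] on are allowed, which is mixing and not mere transitivity: gaps [g] and
    [g + 1] yield the consecutive differences of twin progressions. *)
Definition gluing (L : set (seq bool)) (g : nat) : Prop :=
  forall u v n, L u -> L v -> g <= n ->
    exists2 w, size w = n & L (u ++ w ++ v).

(** The [K]-step finite type condition, in the form of merging along an overlap. *)
Definition markov (L : set (seq bool)) (K : nat) : Prop :=
  forall u v w, L (u ++ v) -> L (v ++ w) -> K <= size v -> L (u ++ v ++ w).

(** The positions marked by [m] form an independence set, a certificate for a lower bound on the
    number of words. *)
Definition free_positions (L : set (seq bool)) (m : bitseq) : Prop :=
  forall s, size s = count id m ->
    exists v, [/\ L v, size v = size m & mask m v = s].

(* The proportion of free positions is at least (1 + 1/e)/2; the slack 1/e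
   pays for the positions lost at later stages. *)
Definition dense_freedom (L : set (seq bool)) : Prop :=
  exists2 e, 0 < e & forall l, exists m, [/\ l <= size m,
    size m * e.+1 <= 2 * e * count id m & free_positions L m].

Definition factor_closed (L : set (seq bool)) : Prop :=
  forall u v w, L (u ++ v ++ w) -> L v.

Record mixing_language (L : set (seq bool)) : Prop := MixingLanguage {
  mixing_nil : L [::];
  mixing_factor_closed : factor_closed L;
  mixing_gluing : exists2 g, 0 < g & gluing L g;
  mixing_markov : exists K, markov L K;
  mixing_free : dense_freedom L }.

Lemma mixing_full : mixing_language setT.
Proof.
split=> //.
- by exists 1 => // u v n _ _ _; exists (nseq n false); rewrite ?size_nseq.
- by exists 0.
- exists 1 => // l; exists (nseq l true); rewrite size_nseq count_nseq.
  split=> //; first by rewrite /=; lia.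
  move=> s; rewrite count_nseq mul1n => sz; exists s.
  by rewrite size_nseq -sz mask_true.
Qed.

Lemma factor_closed_prefix L u v : factor_closed L -> L (u ++ v) -> L u.
Proof. by move=> fL; apply: (fL [::]). Qed.

Lemma factor_closed_suffix L u v : factor_closed L -> L (u ++ v) -> L v.
Proof. by move=> fL Luv; apply: (fL u v [::]); rewrite cats0. Qed.

Lemma factor_closed_occurs_at L u j v :
  factor_closed L -> occurs_at u j v -> L v -> L u.
Proof. by move=> fL [a [b [-> _]]] /fL. Qed.

(** Copies of [u] are separated by fillers of the common length [n]; the fillers themselves may
    differ. *)
Lemma progression_ex L g u n T :
  factor_closed L -> gluing L g -> L u -> g <= n ->
  exists2 v, L v & progression u (size u + n) T v.
Proof.
move=> fL gL Lu le_gn.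
(* With start 0, the induction prepends one copy of [u] and shifts the others by one period. *)
suff [v [Lv pv]] : exists v, L v /\
    forall t, t <= T -> occurs_at u (t * (size u + n)) v.
  by exists v => //; exists 0.
elim: T => [|T [v [Lv pv]]].
  exists u; split=> // t; rewrite leqn0 => /eqP->; exact: occurs_at_refl.
have [w sw Lw] := gL _ _ _ Lu Lv le_gn.
exists (u ++ w ++ v); split=> // -[_|t /pv ut].
  exact/occurs_at_catr/occurs_at_refl.
by rewrite catA mulSn -{1}sw -size_cat; apply: occurs_at_catl.
Qed.

Lemma twin_progressions_ex L g u T :
  factor_closed L -> gluing L g -> L u ->
  exists2 v, L v & twin_progressions u T v.
Proof.
move=> fL gL Lu.
have [v Lv pv] := progression_ex T fL gL Lu (leqnn g).
have [w Lw pw] := progression_ex T fL gL Lu (leqnSn g).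
have [x _ Lx] := gL _ _ _ Lv Lw (leqnn g).
exists (v ++ x ++ w) => //; exists (size u + g); split.
  exact: progression_catr.
by rewrite -addnS; do 2!apply: progression_catl.
Qed.

(** Only finitely many words [u] are concerned, so words carrying their progressions can be glued
    one after another. *)
Lemma universal_word L g N T : L [::] -> factor_closed L -> gluing L g ->
  exists2 P, L P & forall u, L u -> size u <= N -> twin_progressions u T P.
Proof.
move=> L0 fL gL.
have [P LP Pu] : exists2 P, L P & forall u : seq bool,
    u \in flatten [seq [seq val t | t : n.-tuple bool] | n <- iota 0 N.+1] ->
    L u -> twin_progressions u T P.
  elim: flatten => [|u s [P LP Ps]]; first by exists [::].
  have [Lu|nLu] := pselect (L u); last first.
    by exists P => // v; rewrite inE => /predU1P[->|/Ps].
  have [v Lv pv] := twin_progressions_ex T fL gL Lu.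
  have [x _ Lx] := gL _ _ _ LP Lv (leqnn g).
  exists (P ++ x ++ v) => // w; rewrite inE => /predU1P[->|/Ps ws] Lw.
    apply: twin_progressions_infix pv.
    by rewrite catA; apply/occurs_at_catl/occurs_at_refl.
  apply: twin_progressions_infix (ws Lw).
  exact/occurs_at_catr/occurs_at_refl.
exists P => // u Lu szu; apply: Pu => //; apply/flattenP.
exists [seq val t | t : (size u).-tuple bool].
  by apply/mapP; exists (size u) => //; rewrite mem_iota.
by apply/mapP; exists (in_tuple u) => //; rewrite mem_enum.
Qed.

(** * Forcing a word [P] to occur in every window of length [S] *)

Section Anchored.
Variables (L : set (seq bool)) (P : seq bool) (S g : nat).
Hypothesis (fL : factor_closed L) (gL : gluing L g) (LP : L P).

(** The copies of [P] at both ends serve the windows that cross a junction when two such words are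
    joined. *)
Definition anchored : set (seq bool) := [set B |
  [/\ L B, occurs_at P 0 B, occurs_at P (size B - size P) B &
   forall i, i + S <= size B ->
     exists j, [/\ i <= j, j + size P <= i + S & occurs_at P j B]]].

Definition anchored_language : set (seq bool) :=
  [set u | exists a b, anchored (a ++ u ++ b)].

Lemma anchored_language_window u : anchored_language u -> S <= size u ->
  exists j, occurs_at P j u.
Proof.
move=> [a [b [_ _ _ wB]]] Su; have [|j [aj jS oj]] := wB (size a).
  by rewrite !size_cat; lia.
exists (j - size a); apply: (@occurs_at_catrI _ _ _ b); last by lia.
exact: occurs_at_catlI.
Qed.

Hypothesis (leS : 3 * size P + 2 * g <= S) (g0 : 0 < g).

Lemma anchored_self : anchored P.
Proof.
split=> //; first exact: occurs_at_refl.
  by rewrite subnn; exact: occurs_at_refl.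
move=> i; lia.
Qed.

(** A window inside neither [B] nor [C] contains the last [P] of [B] or starts after the beginning
    of that [P]. In the latter case it reaches the end of the first [P] of [C], because [S] exceeds
    the gap by two lengths of [P]. *)
Lemma anchored_cat B W C : anchored B -> anchored C -> L (B ++ W ++ C) ->
  size W + 2 * size P <= S -> anchored (B ++ W ++ C).
Proof.
move=> [LB PB BP wB] [LC PC CP wC] LBC szW; split=> //.
- exact: occurs_at_catr.
- have := occurs_at_catl (B ++ W) CP; rewrite -catA.
  congr occurs_at; have := occurs_at_size CP; rewrite !size_cat; lia.
move=> i; rewrite !size_cat => szi.
have [iB|iB] := leqP (i + S) (size B).
  by have [j [? ? ?]] := wB i iB; exists j; split=> //; apply: occurs_at_catr.
have [iC|iC] := leqP (size B + size W) i.
  have [|j [? ? oj]] := wC (i - (size B + size W)); first lia.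
  exists (size B + size W + j); split; [lia..|].
  by rewrite catA -size_cat; apply: occurs_at_catl.
have [iP|iP] := leqP i (size B - size P).
  have szP := occurs_at_size BP.
  by exists (size B - size P); split; [lia..|]; apply: occurs_at_catr.
exists (size B + size W); split; [lia..|].
rewrite catA -size_cat -[size (B ++ W)]addn0; exact: occurs_at_catl.
Qed.

(** A short gap is bridged in [L]. In a gap with [n + 2 * size P > S], one more [P] is placed after
    [g] letters; the bound on [S] leaves [n - g - size P >= g], so the induction continues. *)
Lemma anchored_gluing B C n : anchored B -> anchored C -> g <= n ->
  exists2 W, size W = n & anchored (B ++ W ++ C).
Proof.
elim/ltn_ind: n B => n IH B aB aC gn.
have [LB PB BP _] := aB; have [LC _ _ _] := aC.
have [small|big] := leqP (n + 2 * size P) S.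
  have [W szW LW] := gL LB LC gn.
  by exists W => //; apply: anchored_cat; rewrite ?szW.
have [W1 szW1 LW1] := gL LB LP (leqnn g).
have aB1 : anchored (B ++ W1 ++ P).
  by apply: anchored_cat => //; [exact: anchored_self|lia].
have [||W2 szW2 aW2] := IH (n - g - size P) _ _ aB1 aC; [lia..|].
exists (W1 ++ P ++ W2); first by rewrite !size_cat; lia.
by rewrite -!catA in aW2 *.
Qed.

(* Cut the completion of u just after the first occurrence of P beyond u. *)
Lemma anchored_trimr a u b : anchored (a ++ u ++ b) ->
  exists2 b', size b' <= S & anchored (a ++ u ++ b').
Proof.
move=> aB; have [bS|bS] := leqP (size b) S; first by exists b.
have [LB PB BP wB] := aB.
have [|j [ij jS [c [d [E szc]]]]] := wB (size (a ++ u)).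
  by rewrite !size_cat; lia.
have szB' : size (a ++ u) <= size (c ++ P) by move: ij; rewrite !size_cat; lia.
have [b' Eb'] : exists b', c ++ P = a ++ u ++ b'.
  exists (drop (size (a ++ u)) (c ++ P)); rewrite catA.
  rewrite -[LHS](cat_take_drop (size (a ++ u))); congr (_ ++ _).
  have := congr1 (take (size (a ++ u))) E.
  by rewrite catA take_size_cat // [c ++ P ++ d]catA takel_cat.
exists b'.
  have := congr1 size Eb'; move: jS; rewrite !size_cat; lia.
rewrite -Eb'; have EB : a ++ u ++ b = (c ++ P) ++ d by rewrite E catA.
split; first by apply: (factor_closed_prefix fL (v := d)); rewrite -EB.
- apply: occurs_at_catrI (_ : occurs_at P 0 ((c ++ P) ++ d)) _.
    by rewrite -EB.
  by rewrite size_cat; lia.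
- rewrite size_cat addnK -[size c]addn0.
  exact/occurs_at_catl/occurs_at_refl.
- move=> i iS; have [|k [ik kS ok]] := wB i.
    by rewrite EB size_cat; lia.
  exists k; split=> //; rewrite EB in ok.
  by apply: occurs_at_catrI ok _; lia.
Qed.

(** Mirror image of the previous trimming: the cut is just before an occurrence of [P] within the
    last [S] letters of [a]. *)
Lemma anchored_triml a u b : anchored (a ++ u ++ b) ->
  exists2 a', size a' <= S & anchored (a' ++ u ++ b).
Proof.
move=> aB; have [bS|bS] := leqP (size a) S; first by exists a.
have [LB PB BP wB] := aB.
have [|j [ij jS [c [d [E szc]]]]] := wB (size a - S).
  by rewrite !size_cat; lia.
have szc' : size c <= size a by lia.
have [a' Ea] : exists a', a = c ++ a'.
  exists (drop (size c) a); rewrite -[LHS](cat_take_drop (size c)).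
  have := congr1 (take (size c)) E.
  by rewrite takel_cat // take_size_cat // => ->.
have Ea' : P ++ d = a' ++ u ++ b.
  move: E; rewrite Ea -catA => /eqP.
  by rewrite eqseq_cat // eqxx => /eqP.
exists a'; first by move: ij bS jS; rewrite Ea size_cat; lia.
rewrite -Ea'; have EB : a ++ u ++ b = c ++ (P ++ d) by rewrite E.
split; first by apply: (factor_closed_suffix fL (u := c)); rewrite -EB.
- exact/occurs_at_catr/occurs_at_refl.
- rewrite EB in BP.
  have := @occurs_at_catlI P _ (P ++ d) c BP; rewrite !size_cat => h.
  have /h : size c <= size c + (size P + size d) - size P by lia.
  by congr occurs_at; lia.
- move=> i iS; have [|k [ik kS ok]] := wB (size c + i).
    by rewrite EB size_cat; lia.
  exists (k - size c); split; [lia..|].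
  by rewrite EB in ok; apply: occurs_at_catlI ok _; lia.
Qed.

Lemma anchored_language_sub u : anchored_language u -> L u.
Proof. by move=> [a [b [/fL]]]. Qed.

Lemma anchored_language_anchored B : anchored B -> anchored_language B.
Proof. by exists [::], [::]; rewrite cats0. Qed.

Lemma anchored_language_factor_closed : factor_closed anchored_language.
Proof.
by move=> u v w [a [b aB]]; exists (a ++ u), (w ++ b); rewrite -!catA in aB *.
Qed.

(** After trimming, the inner completions take at most [2 * S] letters, so at least [g] remain to be
    bridged. *)
Lemma anchored_language_gluing : gluing anchored_language (2 * S + g).
Proof.
move=> u v n [a [b /anchored_trimr[b' szb' aB]]]
  [c [d /anchored_triml[c' szc' aC]]] le_n.
have [|W szW aW] := @anchored_gluing _ _ (n - size b' - size c') aB aC.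
  lia.
exists (b' ++ W ++ c'); first by rewrite !size_cat; lia.
by exists a, d; rewrite -!catA in aW *.
Qed.

(** As [v] has length at least [S], each window of length [S] in the merged word lies in the part up
    to the end of [v] or in the part from the start of [v]. *)
Lemma anchored_language_markov K :
  markov L K -> markov anchored_language (maxn K S).
Proof.
move=> mK u v w [a [b [LB PB BP wB]]] [c [d [LC PC CP wC]]].
rewrite geq_max => /andP[Kv Sv]; exists a, d.
have EL : a ++ (u ++ v ++ w) ++ d = (a ++ u) ++ v ++ (w ++ d) by rewrite -!catA.
rewrite EL; split.
- apply: mK => //.
    by apply: (factor_closed_prefix fL (v := b)); rewrite -!catA in LB *.
  by apply: (factor_closed_suffix fL (u := c)); rewrite -!catA in LC *.
- rewrite [_ ++ _ ++ (w ++ d)]catA; apply: occurs_at_catr.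
  apply: (@occurs_at_catrI _ _ _ b); first by rewrite -!catA in PB *.
  by rewrite !size_cat; lia.
- rewrite -[c ++ _ ++ d]/(c ++ _) -catA in CP.
  have := occurs_at_catlI CP; rewrite !size_cat => h.
  have /h/(occurs_at_catl (a ++ u)) :
    size c <= size c + (size v + (size w + size d)) - size P by lia.
  by congr occurs_at; rewrite !size_cat; lia.
move=> i iS; have [iv|iv] := leqP (i + S) (size (a ++ u ++ v)).
  have [|j [ij jS oj]] := wB i; first by move: iv; rewrite !size_cat; lia.
  exists j; split=> //; rewrite catA; apply: occurs_at_catr.
  rewrite -catA; apply: (@occurs_at_catrI _ _ _ b); last by lia.
  by rewrite -!catA in oj *.
move: iS iv; rewrite !size_cat => iS iv.
have [|j [ij jS oj]] := wC (size c + (i - size (a ++ u))).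
  by rewrite !size_cat; lia.
rewrite !size_cat in ij jS.
exists (size (a ++ u) + (j - size c)); rewrite !size_cat; split; [lia..|].
rewrite -size_cat; apply: occurs_at_catl; apply: occurs_at_catlI; last lia.
by rewrite -!catA in oj *.
Qed.

(** Each block is [P], a filler, a word with prescribed letters at the free positions, and a filler;
    only the third piece contributes free positions. *)
Lemma anchored_language_free m : size m + 2 * size P + 2 * g <= S ->
  free_positions L m -> forall r, free_positions anchored_language
    (flatten (nseq r (nseq (size P + g) false ++ m ++ nseq g false))).
Proof.
move=> szm fm r s szs.
(* The extra [P] at the end makes the word anchored, so that a further block can be put in front. *)
suff [v [av szv mv]] : exists v, [/\ anchored (v ++ P), size v =
      size (flatten (nseq r (nseq (size P + g) false ++ m ++ nseq g false))) &
    mask (flatten (nseq r (nseq (size P + g) false ++ m ++ nseq g false))) v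
      = s].
  exists v; split=> //; apply: (@anchored_language_factor_closed [::] v P).
  exact: anchored_language_anchored.
elim: r s szs => [|r IH] s szs.
  exists [::]; split=> //; first exact: anchored_self.
  by case: s szs.
move: szs; rewrite /= count_cat !count_cat !count_nseq !mul0n /= add0n addn0.
set c := count id m => szs.
have [u [Lu szu mu]] : exists u,
    [/\ L u, size u = size m & mask m u = take c s].
  by apply: fm; rewrite size_takel // szs leq_addr.
have [|v [av szv mv]] := IH (drop c s).
  by rewrite size_drop szs -/c; lia.
have [w1 szw1 Lw1] := gL LP Lu (leqnn g).
have [w2 szw2 Lw2] := gL Lw1 (let: And4 h _ _ _ := av in h) (leqnn g).
exists (((P ++ w1) ++ u ++ w2) ++ v); split.
- have E : (((P ++ w1) ++ u ++ w2) ++ v) ++ P =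
      P ++ (w1 ++ u ++ w2) ++ (v ++ P).
    by rewrite -!catA.
  rewrite E; apply: anchored_cat => //; first exact: anchored_self.
    by rewrite -!catA in Lw2 *.
  by rewrite !size_cat; lia.
- by rewrite !size_cat !size_nseq szv; lia.
- rewrite mask_cat; last by rewrite !size_cat !size_nseq; lia.
  rewrite mask_cat; last by rewrite !size_cat !size_nseq; lia.
  rewrite mask_cat // !mask_false /= mu cats0.
  by rewrite mv cat_take_drop.
Qed.

End Anchored.

(** Words of length at most [N] survive because they occur in [P], which is anchored. *)
Lemma mixing_refine L N : mixing_language L ->
  exists L' S, [/\ mixing_language L', L' `<=` L,
    forall u, L u -> size u <= N -> L' u &
    forall u v, L u -> size u <= N -> L' v -> S <= size v ->
      twin_progressions u N v].
Proof.
move=> [L0 fL [g g0 gL] [K mK] [e e0 fe]].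
have [P LP PN] := universal_word N N L0 fL gL.
(* Each block loses [c] positions. With [x = size m] and [y] free positions,
   [x * (e + 1) <= 2 * e * y] and [x >= c * (2 * e + 1)] give [(x + c) * (2 * e + 1) <= 4 * e * y]:
   the slack is halved. *)
pose c := 2 * g + size P.
have [m [szm em fm]] := fe (c * (2 * e).+1).
pose S := size m + 3 * size P + 2 * g.
have leS : 3 * size P + 2 * g <= S by rewrite /S; lia.
have aP : anchored L P S P by exact: (@anchored_self L P S g).
exists (anchored_language L P S), S; split.
- split.
  + by exists P, [::]; rewrite /= cats0.
  + exact: (@anchored_language_factor_closed L P S).
  + exists (2 * S + g); first lia.
    exact: (@anchored_language_gluing L P S g).
  + by exists (maxn K S); apply: (@anchored_language_markov L P S g).
  + exists (2 * e); first lia.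
    move=> l; pose m1 := nseq (size P + g) false ++ m ++ nseq g false.
    have szm1 : size m1 = size m + c by rewrite !size_cat !size_nseq /c; lia.
    have cm1 : count id m1 = count id m.
      by rewrite !count_cat !count_nseq !mul0n add0n addn0.
    exists (flatten (nseq l m1)); split.
    * rewrite size_flatten /shape map_nseq sumn_nseq szm1.
      by apply: leq_pmull; rewrite /c; lia.
    * rewrite size_flatten count_flatten /shape !map_nseq !sumn_nseq szm1 cm1.
      rewrite mulnAC [X in _ <= X]mulnA leq_mul2r; apply/orP; right.
      move: szm em; set x := size m; set y := count _ _; nia.
    * by apply: (@anchored_language_free L P S g) => //; rewrite /S; lia.
- exact: anchored_language_sub.
- move=> u Lu szu; have [d [[p up] _]] := PN u Lu szu.
  apply: factor_closed_occurs_at (up 0 _) _ => //.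
    exact: (@anchored_language_factor_closed L P S).
  exact: anchored_language_anchored.
- move=> u v Lu szu Lv szv.
  have [j oj] := anchored_language_window Lv szv.
  exact: twin_progressions_infix oj (PN u Lu szu).
Qed.

(** * Iterated refinement and the limit language *)

Lemma homo_ltn_geq_id (f : nat -> nat) n :
  {homo f : m n / m < n} -> n <= f n.
Proof. by move=> fS; elim: n => // n /leq_ltn_trans; apply; exact: fS. Qed.

Lemma twin_progressions_leq u T T' v :
  T <= T' -> twin_progressions u T' v -> twin_progressions u T v.
Proof.
by move=> TT' [d [[p h] [q k]]]; exists d; split;
  [exists p|exists q] => t tT; [apply: h|apply: k]; apply: leq_trans TT'.
Qed.

Section Refinement.
Variables (i j : nat -> nat).
Hypothesis (i_homo : {homo i : m n / m < n}) (j_homo : {homo j : m n / m < n}).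

(** The index tells which given interval the stage uses; bundling the proof of mixing allows
    iteration by choice. *)
Definition stage := {p : set (seq bool) * nat | mixing_language p.1}.
Definition stage_language (p : stage) : set (seq bool) := (sval p).1.
Definition stage_index (p : stage) : nat := (sval p).2.
Definition stage_length (p : stage) : nat :=
  i (stage_index p) + j (stage_index p).

(** The mask [m] is short enough for its fillings to survive all later stages, and at least as long
    as the index, so that arbitrarily long masks reach the limit. *)
Definition refines (p q : stage) : Prop :=
  [/\ stage_index p < stage_index q,
      stage_language q `<=` stage_language p,
      exists2 K, markov (stage_language p) K & K < i (stage_index q),
      exists m, [/\ stage_index p <= size m <= stage_length q,
        size m <= 2 * count id m & free_positions (stage_language p) m] &
      (forall u, stage_language p u -> size u <= stage_length q ->
         stage_language q u) /\
      exists S, forall u v, stage_language p u -> size u <= stage_length q ->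
        stage_language q v -> S <= size v ->
        twin_progressions u (stage_length q) v].

Lemma refines_ex p : exists q, refines p q.
Proof.
case: p => -[L n0] /= mL.
have [_ _ _ [K mK] [e e0 fe]] := mL.
have [m [szm em fm]] := fe n0.
(* Since [i n >= n], this one index exceeds the old index, puts [K] below [i n], and leaves room for
   [m]. *)
pose n := maxn n0.+1 (maxn K.+1 (size m)).
have in_ := homo_ltn_geq_id n i_homo.
have [L' [S [mL' sub h1 h2]]] := mixing_refine (i n + j n) mL.
exists (exist _ (L', n) mL'); split=> //=.
- by rewrite /stage_index /= /n; lia.
- by exists K => //; apply: leq_trans in_; rewrite /n; lia.
- exists m; split=> //.
    rewrite szm; apply: leq_trans (leq_addr _ _).
    by apply: leq_trans in_; rewrite /n; lia.
  move: em; set x := size m; set y := count _ _ => em.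
  have e1 : x * e <= 2 * y * e by nia.
  by rewrite leq_pmul2r in e1.
- by split=> //; exists S.
Qed.

(** The limit is the intersection of the stages. A word of stage [k] of length at most [N k.+1] is
    never removed later, so statements on words of bounded length pass from one stage to the
    limit. *)
Lemma limit_language : exists L : set (seq bool),
  [/\ L [::] /\ factor_closed L,
      forall w, L w -> exists a b, L (a :: w ++ [:: b]),
      forall u T, L u -> exists S, forall v, L v -> S <= size v ->
        twin_progressions u T v,
      forall N, exists2 n, N <= n & forall a v b,
        i n < (size v).+2 <= i n + j n ->
        L (a :: v) -> L (v ++ [:: b]) -> L (a :: v ++ [:: b]) &
      forall l, exists m,
        [/\ l <= size m, size m <= 2 * count id m & free_positions L m]].
Proof.
have [f fP] := choice refines_ex.
pose st k := iter k f (exist _ (setT, 0) mixing_full : stage).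
have ref k : refines (st k) (st k.+1) by exact: fP.
pose L k := stage_language (st k); pose n k := stage_index (st k).
pose N k := stage_length (st k).
have mL k : mixing_language (L k) by rewrite /L; case: (st k).
have nS k : n k < n k.+1 by case: (ref k).
have nk k : k <= n k by elim: k => // k /leq_ltn_trans; apply.
have NS k : N k < N k.+1.
  rewrite /N /stage_length -addSn leq_add //; first exact: i_homo (nS k).
  exact: ltnW (j_homo (nS k)).
have LS k : L k.+1 `<=` L k by case: (ref k).
have LNS k u : L k u -> size u <= N k.+1 -> L k.+1 u.
  by case: (ref k) => _ _ _ _ [h _]; exact: h.
pose L' := [set u | forall k, L k u].
have kN k : k <= N k by elim: k => // k /leq_ltn_trans; apply.
have LL' k u : L k u -> size u <= N k.+1 -> L' u.
  move=> Lk szu; have up d : L (k + d) u.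
    elim: d => [|d IH]; first by rewrite addn0.
    rewrite addnS; apply: LNS => //; apply: leq_trans szu _.
    elim: d {IH} => [|d IH]; first by rewrite addn0.
    by apply: leq_trans IH _; rewrite addnS ltnW.
  have down d l : L (l + d) u -> L l u.
    by elim: d => [|d IH]; rewrite ?addn0 // addnS => /LS.
  by move=> l; apply: (down k); rewrite addnC.
have fcL : factor_closed L'.
  by move=> u v w Lu k; apply: mixing_factor_closed (Lu k).
exists L'; split.
- by split=> // k; case: (mL k).
- move=> w Lw; pose k := (size w).+2.
  have [L0 fL [g g0 gL] _ _] := mL k.
  (* Gluing [w] to the empty word on both sides gives nonempty fillers, as [g > 0]; only their
     letters next to [w] are kept. *)
  have [x szx Lx] := gL _ _ _ (Lw k) L0 (leqnn g).
  have [y szy Ly] := gL _ _ _ L0 Lx (leqnn g).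
  case: x szx Lx Ly => [|b x] szx Lx Ly; first by move: g0; rewrite -szx.
  case/lastP: y szy Ly => [|y a] szy Ly; first by move: g0; rewrite -szy.
  exists a, b; apply: (LL' k).
    apply: (fL y _ x); move: Ly.
    by rewrite -cats1 cats0 /= -!catA.
  rewrite /= size_cat /= addn1; apply: leq_trans (kN _) _; exact: ltnW.
- move=> u T Lu; pose k := maxn (size u) T.
  have [_ _ _ _ [_ [S hS]]] := ref k.
  have NN : k <= N k.+1 by apply: leq_trans (kN _) _; exact: ltnW.
  exists S => v Lv szv; apply: (@twin_progressions_leq _ _ (N k.+1)).
    by apply: leq_trans NN; exact: leq_maxr.
  apply: hS => //; first exact: Lu.
    by apply: leq_trans NN; exact: leq_maxl.
  exact: Lv.
- move=> M; have [_ _ [K mK KI] _ _] := ref M.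
  exists (n M.+1); first by apply: leq_trans (nk _) _; exact: ltnW.
  (* From [K < i n < size v + 2] follows [K <= size v], the overlap needed for merging. *)
  move=> a v b /andP[ltv gev] La Lb; apply: (LL' M).
    apply: (mK [:: a] v [:: b]) => //; [exact: La|exact: Lb|].
    by move: KI ltv; rewrite -/(n M.+1) -/(st M.+1); lia.
  by rewrite /= size_cat addn1.
- move=> l; have [_ _ _ [m [/andP[lm mN] cm fm]] _] := ref l.
  exists m; split=> //; first exact: leq_trans (nk _) lm.
  move=> s /fm[v [Lv szv mv]]; exists v; split=> //.
  by apply: (LL' l) => //; rewrite szv.
Qed.

End Refinement.

End WordLanguages.

(** * Topology of the full shift through central windows *)

Section FullShift.
Variable A : finType.
Implicit Types (x y : fullshift A) (X : set (fullshift A)).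

Definition agree (M : nat) x y : Prop :=
  forall i : int, (`|i| <= M)%N -> x i = y i.

Lemma agree_nbhs M x : nbhs x [set y | agree M x y].
Proof.
have coord (i : int) : nbhs x [set y | y i = x i].
  apply: (@proj_continuous int (fun _ => discrete_topology A) i x [set x i]).
  exact: (@discrete_set1 (discrete_topology A)).
have FF : Filter (nbhs x) := nbhs_filter x.
suff H n : nbhs x [set y | forall m, (m < n)%N ->
    x m%:Z = y m%:Z /\ x (- m%:Z) = y (- m%:Z)].
  apply: (@filterS _ (nbhs x) FF _ _ _ (H M.+1)) => y h i iM.
  have [h1 h2] := h `|i|%N iM.
  by case: (intP i) h1 h2 => [|k|k]; rewrite ?abszN.
elim: n => [|n IH].
  by apply: (@filterS _ (nbhs x) FF setT) filterT => y _ m; rewrite ltn0.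
apply: (@filterS3 _ (nbhs x) FF _ _ _ _ _ IH (coord n) (coord (- n%:Z))).
move=> y h e1 e2 m; rewrite ltnS leq_eqVlt => /orP[/eqP->|/h //].
by rewrite e1 e2.
Qed.

Lemma agree_cvg (u : nat -> fullshift A) x :
  (forall M, agree M x (u M)) -> u @ \oo --> x.
Proof.
move=> ux; apply/cvg_sup => i U [_ [[V _ <-] Vx sub]].
exists `|i|%N => // n /= le_in; apply: sub => /=.
by rewrite -(ux n i le_in).
Qed.

Lemma closure_agree X x :
  closure X x <-> forall M, exists2 y, X y & agree M x y.
Proof.
split=> [cX M|h].
  by have [y [Xy xy]] := cX _ (agree_nbhs M x); exists y.
have /choice[u uX] M : exists y, X y /\ agree M x y.
  by have [y] := h M; exists y.
apply: (@closed_cvg _ _ \oo _ u (closure X) (@closed_closure _ X)).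
  by apply: nearW => n; apply/subset_closure; case: (uX n).
by apply: agree_cvg => M; case: (uX M).
Qed.

Definition right_shift x : fullshift A := fun i => x (i - 1).

Lemma right_shiftK : cancel right_shift (@left_shift A).
Proof.
by move=> x; apply/funext => i; rewrite /left_shift /right_shift addrK.
Qed.

Lemma iter_left_shift n x i : iter n (@left_shift A) x i = x (i + n%:Z).
Proof.
elim: n i => [|n IH] i; first by rewrite addr0.
by rewrite iterS /left_shift IH; congr x; lia.
Qed.

End FullShift.

Lemma iter_prod_shift (A B : finType) n (p : fullshift A * fullshift B) :
  iter n (@prod_shift A B) p =
  (iter n (@left_shift A) p.1, iter n (@left_shift B) p.2).
Proof. by elim: n => [|n IH]; [case: p|rewrite !iterS IH]. Qed.

(** * Minimality from dense forward orbits *)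

Section Subsystem.
Variables (T : topologicalType) (f : T -> T).

Lemma subsystem_iter (Y : set T) y n : subsystem f Y -> Y y -> Y (iter n f y).
Proof.
move=> [_ fY] Yy; elim: n => // n IH.
by rewrite iterS -fY; exists (iter n f y).
Qed.

(** A nonempty subsystem contains a forward orbit and, being closed, the limits of sequences along
    it. *)
Lemma minimal_orbits (X : set T) : subsystem f X ->
  (forall x y, X x -> X y -> exists s : nat -> nat,
     (fun n => iter (s n) f y) @ \oo --> x) ->
  minimal f X.
Proof.
move=> subX dense; split=> // Y subY [YX nXY].
apply/eqP/negPn/negP => /set0P[y Yy]; apply: nXY => x Xx.
have [s cvs] := dense x y Xx (YX _ Yy).
have [cY _] := subY.
apply: (@closed_cvg _ _ \oo _ (fun n => iter (s n) f y) Y cY) => //.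
by apply: nearW => n; exact: subsystem_iter.
Qed.

End Subsystem.

(** * Blocks, and the subshift defined by a language *)

Section Blocks.
Variable A : finType.
Implicit Types (x y : fullshift A) (X : set (fullshift A)).

Lemma size_block x k n : size (block x k n) = n.
Proof. by rewrite size_map size_iota. Qed.

Lemma nth_block a x k n m : (m < n)%N -> nth a (block x k n) m = x (k + m%:Z).
Proof. by move=> mn; rewrite (nth_map 0%N) ?size_iota // nth_iota. Qed.

Lemma block_left_shift x k n : block (left_shift x) k n = block x (k + 1) n.
Proof. by apply: eq_map => i; rewrite /left_shift; congr x; lia. Qed.

Lemma block_right_shift x k n : block (right_shift x) k n = block x (k - 1) n.
Proof. by apply: eq_map => i; rewrite /right_shift; congr x; lia. Qed.

Lemma sft_cover_eq X k l :
  (forall m, (k < m <= k + l)%N -> min_forbidden X m = set0) ->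
  sft_cover X k = sft_cover X (k + l).
Proof.
move=> gap; apply/seteqP; split=> x Xx m w /andP[m1 mk] mw; last first.
  by apply: Xx (mw); rewrite m1 (leq_trans mk) ?leq_addr.
have [mk'|mk'] := leqP m k; first by apply: Xx (mw); rewrite m1.
by move: mw; rewrite gap ?mk' // => -[].
Qed.

End Blocks.

Definition language_subshift (L : set (seq bool)) : set (fullshift bool) :=
  [set x | forall k n, L (block x k n)].

Section LanguageSubshift.
Variable L : set (seq bool).
Let X := language_subshift L.

Lemma block_agree (A : finType) (x y : fullshift A) M k n :
  agree M x y -> (`|k| + n <= M)%N -> block x k n = block y k n.
Proof.
move=> xy kn; rewrite /block; apply/eq_in_map => m; rewrite mem_iota => mn.
by apply: xy; lia.
Qed.

Lemma language_subshift_subshift : subshift X.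
Proof.
split.
  move=> x /closure_agree cx k n.
  by have [y Xy xy] := cx (`|k| + n)%N; rewrite (block_agree xy).
apply/seteqP; split=> [_ [x Xx <-] k n|x Xx]; first by rewrite block_left_shift.
exists (right_shift x); last exact: right_shiftK.
by move=> k n; rewrite block_right_shift.
Qed.

Hypothesis fL : factor_closed L.
Hypothesis eL : forall w, L w -> exists a b, L (a :: w ++ [:: b]).

(** Extending [w] by one letter on each side again and again yields nested words [W n], whose union
    is a point of the subshift with [w] at position 0. *)
Lemma language_language_subshift : language X = L.
Proof.
apply/seteqP; split=> [w [x Xx [k <-]]|w Lw]; first exact: Xx.
have /choice[e eP] v : exists v', L v ->
    exists a b, v' = a :: v ++ [:: b] /\ L v'.
  have [/eL[a [b h]]|nLv] := pselect (L v); last by exists v.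
  by exists (a :: v ++ [:: b]) => _; exists a, b.
pose W n := iter n e w.
have LW n : L (W n).
  elim: n => [//|n IH]; rewrite /W iterS -/(W n).
  by have [a [b []]] := eP _ IH.
have WS n : exists a b, W n.+1 = a :: W n ++ [:: b].
  by have [a [b [E _]]] := eP _ (LW n); exists a, b; rewrite -E.
have szW n : size (W n) = (size w + 2 * n)%N.
  elim: n => [|n IH]; first by rewrite addn0.
  by have [a [b ->]] := WS n; rewrite /= size_cat IH /=; lia.
have nthW n d q : (q < size (W n))%N ->
    nth false (W (n + d)%N) (q + d)%N = nth false (W n) q.
  elim: d => [|d IH] qn; first by rewrite !addn0.
  have [a [b E]] := WS (n + d)%N.
  rewrite !addnS E /= nth_cat ifT ?IH //.
  by move: qn; rewrite !szW; lia.
(* Position [z] is covered by [W n] as soon as [n > |z|], at index [z + n]; [xE] shows that every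
   [W n] covering [z] gives the same letter. *)
pose x : fullshift bool := fun z : int =>
  nth false (W (absz z).+1) (absz (z + (absz z).+1%:Z)).
have xE n (z : int) : - n%:Z <= z < (size w + n)%:Z ->
    x z = nth false (W n) (absz (z + n%:Z)).
  move=> zn; rewrite /x; set l := (absz z).+1.
  have [nz|nz] := leqP n l.
    have E : l = (n + (l - n))%N by lia.
    have -> : absz (z + l%:Z) = (absz (z + n%:Z)%R + (l - n))%N by lia.
    by rewrite {1}E nthW // szW; lia.
  have E : n = (l + (n - l))%N by lia.
  have -> : absz (z + n%:Z) = (absz (z + l%:Z)%R + (n - l))%N by lia.
  by rewrite {1}E nthW // szW; lia.
have blockE n k l : - n%:Z <= k -> k + l%:Z <= (size w + n)%:Z ->
    block x k l = take l (drop (absz (k + n%:Z)) (W n)).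
  move=> kn kl; apply: (@eq_from_nth _ false) => [|m].
    by rewrite size_block size_takel // size_drop szW; lia.
  rewrite size_block => ml; rewrite nth_block // nth_take // nth_drop.
  by rewrite (xE n); [congr nth|]; lia.
exists x.
  move=> k l; rewrite (blockE (absz k + l)%N); [|lia|lia].
  set q := absz (k + _); set v := W _; set s := drop q v.
  apply: (fL (u := take q v) (w := drop l s)).
  by rewrite cat_take_drop /s cat_take_drop; exact: LW.
exists 0; rewrite (blockE 0%N) // ?addn0 //=.
by rewrite drop0 take_size.
Qed.

End LanguageSubshift.

(** * Upper Banach density and entropy *)

Section Limsup.
Variable R : realType.

Lemma limn_esup_ge (u : nat -> \bar R) c :
  (forall N, exists2 n, (N <= n)%N & (c <= u n)%E) -> (c <= limn_esup u)%E.
Proof.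
move=> uc; rewrite limn_esup_lim; apply: lime_ge; first exact: is_cvg_esups.
apply: nearW => N; have [n Nn cn] := uc N.
by apply: le_trans cn _; apply: ereal_sup_ubound; exists n.
Qed.

Lemma upper_banach_density1 (S : set nat) :
  (forall n, exists k, forall m, (k <= m < k + n)%N -> S m) ->
  upper_banach_density R S = 1%E.
Proof.
move=> gap; apply: (@cvg_limn_einf_sup R _ 1%E _).2.
(* The supremum over [k] is exactly 1 for each [n >= 1]; at [n = 0] the quotient is [0 / 0], which
   is 0. *)
apply: cvg_near_cst; exists 1%N => // n /= n0.
have n0R : (0 : R) < n%:R by rewrite ltr0n.
apply/eqP; rewrite eq_le; apply/andP; split.
  apply: ge_ereal_sup => _ [k _ <-]; rewrite lee_fin ler_pdivrMr // mul1r.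
  by rewrite ler_nat (leq_trans (count_size _ _)) ?size_iota.
have [k Sk] := gap n; apply: ereal_sup_ubound; exists k => //.
have /eqP -> : count (fun m => `[< S m >]) (iota k n) == n.
  rewrite -[X in _ == X](size_iota k) -all_count.
  by apply/allP => m; rewrite mem_iota => /Sk /asboolP.
by rewrite divff // gt_eqF.
Qed.

(** Keeping only the free positions maps the words of length [size m] onto all bit strings of length
    [count id m]. *)
Lemma complexity_free (X : set (fullshift bool)) m :
  free_positions (language X) m -> (2 ^ count id m <= complexity X (size m))%N.
Proof.
move=> fm; rewrite /complexity -[2%N]card_bool -card_tuple -cardsT.
set D := [set t | _]%SET.
pose g (t : (size m).-tuple bool) : (count id m).-tuple bool :=
  insubd (nseq_tuple _ false) (mask m t).
have gE t : g t = mask m t :> seq bool.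
  by rewrite val_insubd size_mask ?size_tuple ?eqxx.
apply: leq_trans _ (leq_imset_card g D).
apply/subset_leq_card/fintype.subsetP => s _.
have [|v [Lv /eqP szv mv]] := fm s; first by rewrite size_tuple.
apply/imsetP; exists (Tuple szv); first by rewrite inE; apply/asboolP.
by apply/val_inj; exact: etrans (esym mv) (esym (gE (Tuple szv))).
Qed.

(** Half of the positions being free, the entropy is at least [ln 2 / 2]. *)
Lemma topological_entropy_free (X : set (fullshift bool)) :
  (forall l, exists m, [/\ (l <= size m)%N, (size m <= 2 * count id m)%N &
     free_positions (language X) m]) ->
  (0 < topological_entropy R X)%E.
Proof.
move=> fX; have ln2 : (0 : R) < ln 2 by rewrite ln_gt0 ?ltr1n.
apply: (@lt_le_trans _ _ (ln 2 / 2)%:E); first by rewrite lte_fin divr_gt0.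
apply: limn_esup_ge => N; have [m [lm cm fm]] := fX N.+1.
exists (size m); first exact: ltnW.
have m0 : (0 : R) < (size m)%:R by rewrite ltr0n (leq_ltn_trans _ lm).
have c2 : (2 ^+ count id m : R) <= (complexity X (size m))%:R.
  by rewrite -natrX ler_nat complexity_free.
have : (count id m)%:R * ln 2 <= ln ((complexity X (size m))%:R : R).
  rewrite mulr_natl -lnXn // ler_ln ?posrE ?exprn_gt0 //.
  by apply: lt_le_trans c2; rewrite exprn_gt0.
move=> h; rewrite lee_fin ler_pdivlMr //; apply: le_trans h.
have : ((size m)%:R : R) <= 2 * (count id m)%:R by rewrite -natrM ler_nat.
set a := _%:R; set b := _%:R; nra.
Qed.
End Limsup.

(** * Multiples on the circle: Dirichlet approximation and uniform density *)

Section DenseMultiples.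
Variable R : realType.
Implicit Types (theta alpha eps eta delta y : R).

Definition frac y : R := y - (Num.floor y)%:~R.

Lemma frac_itv y : 0 <= frac y < 1.
Proof.
have := floor_itv y; rewrite /frac intrD => /andP[h1 h2].
by rewrite subr_ge0 h1 ltrBlDr addrC.
Qed.

Lemma frac_id y : 0 <= y < 1 -> frac y = y.
Proof. by move=> y01; rewrite /frac (@floor_def _ y 0) ?subr0. Qed.

Lemma fracD_int y (m : int) : frac (y + m%:~R) = frac y.
Proof. by rewrite /frac floorDrz ?intr_int // intrKfloor intrD; ring. Qed.

(* The integer m accounts for reduction modulo 1. *)
Definition spread T eps theta : Prop :=
  forall y, exists2 t, (t <= T)%N &
    exists m : int, 0 < t%:R * theta - y - m%:~R < eps.

Lemma spread_leq T T' eps theta :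
  (T <= T')%N -> spread T eps theta -> spread T' eps theta.
Proof.
by move=> TT' h y; have [t tT e] := h y; exists t => //; apply: leq_trans TT'.
Qed.

(** Steps shorter than [eps] cannot jump over an arc of length [eps], and steps of at least [eta] go
    once around in about [1 / eta] steps. *)
Lemma spread_small T eps eta delta : 0 < eta <= `|delta| -> `|delta| < eps ->
  eta^-1 + 1 <= T%:R -> spread T eps delta.
Proof.
move=> /andP[eta0 etad] de leT.
wlog d0 : delta etad de / 0 < delta.
  move=> H; have [d0|d0] := ltP 0 delta; first exact: H.
  have dN : 0 < - delta.
    rewrite oppr_gt0 lt_neqAle d0 andbT -normr_eq0.
    by rewrite gt_eqF // (lt_le_trans eta0).
  (* The target [- (y + eps)] reflects the open interval from 0 to [eps] onto itself. *)
  move=> y; have [||//|t tT [m hm]] := H (- delta) _ _ _ (- (y + eps)).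
  - by rewrite normrN.
  - by rewrite normrN.
  exists t => //; exists (- m); rewrite mulrNz; lra.
rewrite gtr0_norm // in etad de => y.
(* The first multiple of [delta] beyond [frac y]. *)
pose s := (Num.trunc (frac y / delta)).+1.
have /andP[f0 f1] := frac_itv y.
have /andP[s1 s2] := truncn_itv (divr_ge0 f0 (ltW d0)).
rewrite ler_pdivlMr // in s1; rewrite ltr_pdivrMr // -/s in s2.
exists s.
  rewrite -(ler_nat R) /s -natr1; apply: le_trans leT.
  rewrite lerD2r; apply: (@le_trans _ _ delta^-1).
    have : (Num.trunc (frac y / delta))%:R * delta <= 1 by lra.
    by rewrite -ler_pdivlMr // mul1r.
  by rewrite lef_pV2 ?posrE.
exists (- Num.floor y); rewrite mulrNz; move: s1 s2.
by rewrite /s -natr1 /frac; lra.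
Qed.

Lemma spread_multiple T eps theta (q : nat) (m : int) :
  spread T eps (q%:R * theta - m%:~R) -> spread (T * q) eps theta.
Proof.
move=> h y; have [t tT [n hn]] := h y; exists (t * q)%N.
  by rewrite leq_mul2r tT orbT.
exists (n + t%:Z * m); move: hn; rewrite natrM intrD intrM.
by rewrite -[t%:Z%:~R]/(t%:R : R); lra.
Qed.

(** Pigeonhole: [Q + 1] multiples of [theta] fall into [Q] arcs of length [1 / Q]. *)
Lemma dirichlet theta Q : (0 < Q)%N ->
  exists2 q, (0 < q <= Q)%N & exists m : int, `|q%:R * theta - m%:~R| < Q%:R^-1.
Proof.
case: Q => // Q _; have Q0 : (0 : R) < Q.+1%:R by rewrite ltr0n.
pose b k := Num.trunc (Q.+1%:R * frac (k%:R * theta)).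
have bP k : (b k)%:R <= Q.+1%:R * frac (k%:R * theta) < (b k).+1%:R.
  have /andP[f0 _] := frac_itv (k%:R * theta).
  by apply: truncn_itv; rewrite mulr_ge0.
have bQ k : (b k < Q.+1)%N.
  have /andP[f0 f1] := frac_itv (k%:R * theta).
  rewrite -(ltr_nat R); have /andP[h _] := bP k; apply: le_lt_trans h _.
  by rewrite gtr_pMr.
pose f (k : 'I_Q.+2) : 'I_Q.+1 := Ordinal (bQ k).
have [k [l [kl E]]] : exists k l : 'I_Q.+2, (k < l)%N /\ b k = b l.
  apply: contrapT => nE; suff /leq_card : injective f by rewrite !card_ord ltnn.
  move=> k l [E]; apply/val_inj/eqP; apply: contrapT => /negP.
  by rewrite neq_ltn => /orP[h|h]; apply: nE; [exists k, l|exists l, k].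
exists (l - k)%N; first by rewrite subn_gt0 kl; have := ltn_ord l; lia.
exists (Num.floor (l%:R * theta) - Num.floor (k%:R * theta)).
have := bP k; have := bP l.
rewrite E -[(b l).+1%:R]natr1 => /andP[h1 h2] /andP[h3 h4].
have -> : (l - k)%:R * theta -
    (Num.floor (l%:R * theta) - Num.floor (k%:R * theta))%:~R =
    frac (l%:R * theta) - frac (k%:R * theta).
  by rewrite natrB ?(ltnW kl) // intrB /frac; ring.
rewrite -[ltRHS]mul1r ltr_pdivlMr // -[X in _ * X](gtr0_norm Q0) -normrM.
by rewrite ltr_norml; apply/andP; split; lra.
Qed.

Lemma irrational_natmul alpha q :
  (0 < q)%N -> irrational alpha -> irrational (q%:R * alpha).
Proof.
move=> q0 ia [r _ rE]; apply: ia; exists (r / q%:R) => //.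
rewrite fmorph_div /= rE ratr_nat mulrC mulKf //.
by rewrite pnatr_eq0 -lt0n.
Qed.

Lemma irrational_neq_int alpha (m : int) :
  irrational alpha -> alpha - m%:~R != 0.
Proof.
move=> ia; rewrite subr_eq0; apply/eqP => E; apply: ia.
by exists m%:~R => //; rewrite ratr_int.
Qed.

Lemma inv_bound eps : 0 < eps -> exists2 Q, (0 < Q)%N & Q%:R^-1 < eps.
Proof.
move=> e0; exists (Num.trunc eps^-1).+1 => //.
have Q0 : (0 : R) < (Num.trunc eps^-1).+1%:R by rewrite ltr0n.
rewrite -[ltRHS]invrK ltf_pV2 ?posrE ?invr_gt0 //.
exact: truncnS_gt.
Qed.

Lemma spread_irrational alpha eps :
  irrational alpha -> 0 < eps -> exists T, spread T eps alpha.
Proof.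
move=> ia e0; have [Q Q0 Qe] := inv_bound e0.
have [q /andP[q0 _] [m qm]] := dirichlet alpha Q0.
have d0 := irrational_neq_int m (irrational_natmul q0 ia).
set d := _ - _ in qm d0.
pose T := (Num.trunc (`|d|^-1 + 1)).+1.
exists (T * q)%N; apply: (@spread_multiple _ _ _ _ m).
apply: (@spread_small _ _ `|d|); first by rewrite normr_gt0 d0 lexx.
  exact: lt_trans qm Qe.
exact/ltW/truncnS_gt.
Qed.

(* By Dirichlet some small multiple q theta is close to an integer. Either it
   is not too close, and then the multiples of q theta advance by small
   steps around the circle, or it is negligible, and then q (theta + alpha)
   behaves as q alpha. *)
Lemma spread_uniform alpha eps : irrational alpha -> 0 < eps ->
  exists T, forall theta, spread T eps theta \/ spread T eps (theta + alpha).
Proof.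
move=> ia e0; have [Q Q0 Qe] := inv_bound e0.
have e2 : 0 < eps / 2 by rewrite divr_gt0.
have /choice[T TP] (q : nat) :
    exists T, (0 < q)%N -> spread T (eps / 2) (q%:R * alpha).
  case: q => [|q]; first by exists 0%N.
  have [T h] := spread_irrational (irrational_natmul (ltn0Sn q) ia) e2.
  by exists T.
pose T1 := (\max_(q < Q.+1) T q)%N.
(* With this threshold, [t] steps of an error at most [eta] add up to less than [eps / 4] for all
   [t <= T1]. *)
pose eta := eps / 4 / T1.+1%:R.
have eta0 : 0 < eta by rewrite !divr_gt0.
pose T2 := (Num.trunc (eta^-1 + 1)).+1.
exists (maxn T1 T2 * Q)%N => theta.
have [q /andP[q0 qQ] [m qm]] := dirichlet theta Q0.
have [big|small] := leP eta `|q%:R * theta - m%:~R|.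
  left; apply: (@spread_leq (T2 * q)); first by rewrite leq_mul // leq_maxr.
  apply: (@spread_multiple _ _ _ _ m); apply: (@spread_small _ _ eta).
  - by rewrite eta0.
  - exact: lt_trans qm Qe.
  - exact/ltW/truncnS_gt.
right; apply: (@spread_leq (T1 * q)); first by rewrite leq_mul // leq_maxl.
apply: (@spread_multiple _ _ _ _ m) => y.
have Tq : spread T1 (eps / 2) (q%:R * alpha).
  have qQ' : (q < Q.+1)%N by [].
  have leT := @leq_bigmax _ (fun i : 'I_Q.+1 => T i) (Ordinal qQ').
  exact: spread_leq leT (TP q q0).
(* Aiming at [y + eps / 4] with precision [eps / 2] leaves a margin of [eps / 4] on both sides for
   the accumulated error. *)
have [t tT [n hn]] := Tq (y + eps / 4).
exists t => //; exists n.
have : `|t%:R * (q%:R * theta - m%:~R)| < eps / 4.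
  rewrite normrM normr_nat; apply: (@le_lt_trans _ _ (t%:R * eta)).
    by rewrite ler_wpM2l // ltW.
  rewrite /eta mulrA ltr_pdivrMr // mulrC ltr_pM2l ?ltr_nat ?ltnS //.
  by rewrite divr_gt0.
by rewrite ltr_norml; lra.
Qed.

End DenseMultiples.

(** * Codings of rotations and their visits to cylinders *)

Section RotationCoding.
Variables (R : realType) (alpha beta : R).
Hypothesis beta01 : 0 < beta < 1.
Implicit Types (x y : R) (z : fullshift bool).

Let Z := rotation_coding alpha beta.

Lemma frac_frac x y : frac (frac x + y) = frac (x + y).
Proof. by rewrite [frac x]/frac addrAC -mulrNz fracD_int. Qed.

Lemma rotation_iterE (j : int) x : 0 <= x < 1 ->
  rotation_iter alpha j x = frac (x + j%:~R * alpha).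
Proof.
move=> x01; have itE a n : iter n (rotation a) x = frac (x + n%:R * a).
  elim: n => [|n IH]; first by rewrite mul0r addr0 frac_id.
  rewrite iterS IH -[LHS]/(frac (frac _ + a)) frac_frac -natr1.
  by congr frac; ring.
case: j => n; rewrite /rotation_iter itE //.
by congr frac; rewrite NegzE mulrNz mulNr mulrN.
Qed.

Lemma itineraryE x (j : int) : 0 <= x < 1 ->
  itinerary alpha beta x j = (beta <= frac (x + j%:~R * alpha)).
Proof.
move=> x01; rewrite /itinerary rotation_iterE // in_itv /=.
by case/andP: (frac_itv (x + j%:~R * alpha)) => -> _; rewrite leNgt.
Qed.

(** Both arcs of the partition contain their left end, so the code is locally constant to the right;
    this is why [spread] approaches its target from one side. *)
Lemma frac_right_continuous x : exists2 e, 0 < e &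
  forall d, 0 <= d < e -> (beta <= frac (x + d)) = (beta <= frac x).
Proof.
have /andP[f0 f1] := frac_itv x; have /andP[b0 b1] := beta01.
have [bf|bf] := leP beta (frac x).
  exists (1 - frac x) => [|d /andP[d0 de]]; first by rewrite subr_gt0.
  by rewrite -frac_frac frac_id; [|apply/andP; split]; lra.
exists (beta - frac x) => [|d /andP[d0 de]]; first by rewrite subr_gt0.
rewrite -frac_frac frac_id; last by apply/andP; split; lra.
by apply/negbTE; rewrite -ltNge; lra.
Qed.

Lemma coding_right_continuous x M : exists2 e, 0 < e &
  forall d (j : int), 0 <= d < e -> (`|j| <= M)%N ->
    (beta <= frac (x + d + j%:~R * alpha)) = (beta <= frac (x + j%:~R * alpha)).
Proof.
have one (j : int) : exists2 e, 0 < e & forall d, 0 <= d < e ->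
    (beta <= frac (x + d + j%:~R * alpha)) = (beta <= frac (x + j%:~R * alpha)).
  have [e e0 he] := frac_right_continuous (x + j%:~R * alpha).
  by exists e => // d /he <-; rewrite addrAC.
elim: M => [|M [e e0 he]].
  have [e e0 he] := one 0; exists e => // d j /he h.
  by rewrite leqn0 absz_eq0 => /eqP->.
have [e1 e10 he1] := one M.+1; have [e2 e20 he2] := one (- M.+1%:Z).
exists (Num.min e (Num.min e1 e2)); first by rewrite !lt_min e0 e10.
move=> d j; rewrite !lt_min => /and4P[d0 de de1 de2] jM.
have [jM'|jM'] := leqP `|j| M; first by apply: he => //; rewrite d0.
have [->|->] : j = M.+1%:Z \/ j = - M.+1%:Z by lia.
  by apply: he1; rewrite d0.
by apply: he2; rewrite d0.
Qed.

(** The bound [T] is fixed before [p], [q] and [d]: a small arc to the right of the point coding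
    [z'] has the right code, and the uniform spreading is applied with [theta = d * alpha], so that
    [theta + alpha = (d + 1) * alpha]. *)
Lemma rotation_coding_visits z z' M : irrational alpha -> Z z -> Z z' ->
  exists T, forall p q d, exists2 t, (t <= T)%N &
    agree M z' (iter (p + t * d) (@left_shift _) z) \/
    agree M z' (iter (q + t * d.+1) (@left_shift _) z).
Proof.
move=> ia /closure_agree cz /closure_agree cz'.
have [_ [x x01 <-] z'x] := cz' M.
rewrite /= in_itv /= in x01.
have [e e0 he] := coding_right_continuous x M.
have [T spr] := spread_uniform ia e0.
exists T => p q d.
(* The point [z] need only follow a true itinerary on the stretch that both progressions can
   reach. *)
have [_ [y y01 <-] zy] := cz (M + (p + q + T * d.+1))%N.
rewrite /= in_itv /= in y01.
have window s : (s <= p + q + T * d.+1)%N ->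
    (exists m : int, 0 < y + s%:R * alpha - x - m%:~R < e) ->
    agree M z' (iter s (@left_shift _) z).
  move=> sN [m /andP[h1 h2]] j jM; rewrite iter_left_shift.
  rewrite z'x // zy; last by lia.
  rewrite !itineraryE //.
  rewrite -(he (y + s%:R * alpha - x - m%:~R)) //; last by rewrite ltW.
  rewrite -(fracD_int _ m) intrD -[s%:Z%:~R]/(s%:R : R).
  by congr (_ <= frac _); ring.
have [h|h] := spr (d%:R * alpha).
  have [t tT [m hm]] := h (x - y - p%:R * alpha).
  exists t => //; left; apply: window.
    by have : (t * d <= T * d.+1)%N; [apply: leq_mul|]; lia.
  by exists m; rewrite natrD natrM; lra.
have [t tT [m hm]] := h (x - y - q%:R * alpha).
exists t => //; right; apply: window.
  by have : (t * d.+1 <= T * d.+1)%N; [apply: leq_mul|]; lia.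
by exists m; rewrite natrD natrM -natr1; lra.
Qed.

Lemma itinerary_left_shift x : 0 <= x < 1 ->
  left_shift (itinerary alpha beta x) = itinerary alpha beta (frac (x + alpha)).
Proof.
move=> x01; apply/funext => j; rewrite /left_shift !itineraryE ?frac_itv //.
by rewrite frac_frac intrD; congr (_ <= frac _); ring.
Qed.

Lemma itinerary_right_shift x : 0 <= x < 1 ->
  right_shift (itinerary alpha beta x) =
  itinerary alpha beta (frac (x - alpha)).
Proof.
move=> x01; apply/funext => j; rewrite /right_shift !itineraryE ?frac_itv //.
by rewrite frac_frac intrB; congr (_ <= frac _); ring.
Qed.

Lemma rotation_coding_subshift : subshift Z.
Proof.
split; first exact: closed_closure.
apply/seteqP; split=> [_ [z /closure_agree cz <-]|z /closure_agree cz].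
  apply/closure_agree => M; have [_ [x x01 <-] zx] := cz M.+1.
  rewrite /= in_itv /= in x01.
  exists (left_shift (itinerary alpha beta x)).
    rewrite itinerary_left_shift //; exists (frac (x + alpha)) => //.
    by rewrite /= in_itv /= frac_itv.
  by move=> j jM; apply: zx; lia.
exists (right_shift z); last exact: right_shiftK.
apply/closure_agree => M; have [_ [x x01 <-] zx] := cz M.+1.
rewrite /= in_itv /= in x01.
exists (right_shift (itinerary alpha beta x)).
  rewrite itinerary_right_shift //; exists (frac (x - alpha)) => //.
  by rewrite /= in_itv /= frac_itv.
by move=> j jM; apply: zx; lia.
Qed.

End RotationCoding.

(** * Assembly: gaps in the forbidden lengths, visits, and minimality *)

Lemma min_forbidden_gap (A : finType) (X : set (fullshift A)) k l : (0 < k)%N ->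
  (forall a v b, (k < (size v).+2 <= k + l)%N -> language X (a :: v) ->
     language X (v ++ [:: b]) -> language X (a :: v ++ [:: b])) ->
  forall m, (k < m <= k + l)%N -> min_forbidden X m = set0.
Proof.
move=> k0 gap m /andP[km mkl]; rewrite -subset0 => w [szw nLw subw].
(* As [k > 0], the word has length at least 2 and reads [a v b], where [a v] and [v b] are proper
   subwords and so lie in the language. *)
case: w szw nLw subw => [|a w]; first by move=> /= E; lia.
case/lastP: w => [|v b]; first by move=> /= E; lia.
rewrite -cats1 => szw nLw subw; apply: nLw.
move: szw; rewrite /= size_cat addn1 => szw.
apply: gap; first by rewrite szw km.
  apply: subw; first by rewrite -cat_cons prefix_infix.
  by apply/eqP => /(congr1 size); rewrite /= size_cat /=; lia.
apply: subw; first exact: (suffix_infix [:: a]).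
by apply/eqP => /(congr1 size); rewrite /= size_cat /=; lia.
Qed.

Lemma language_stable_gap (R : realType) (A : finType) (X : set (fullshift A))
  (i j : nat -> nat) : {homo j : m n / (m < n)%N} ->
  (forall N, exists2 n, (N <= n)%N &
     forall m, (i n < m <= i n + j n)%N -> min_forbidden X m = set0) ->
  language_stable R X.
Proof.
move=> jh gap; apply: upper_banach_density1 => N; have [n Nn gn] := gap N.
exists (i n).+1 => m /andP[h1 h2]; apply: gn; rewrite h1.
have := homo_ltn_geq_id n jh; lia.
Qed.

(** The twin progressions are those of the central block of [x'] in a long block of [x]; the shift
    by [M] moves its start to its centre. *)
Lemma language_subshift_visits (L : set (seq bool)) :
  (forall u T, L u -> exists S, forall v, L v -> (S <= size v)%N ->
        twin_progressions u T v) ->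
  forall x x', language_subshift L x -> language_subshift L x' ->
  forall M T, exists p q d, forall t, (t <= T)%N ->
    agree M x' (iter (p + t * d) (@left_shift _) x) /\
    agree M x' (iter (q + t * d.+1) (@left_shift _) x).
Proof.
move=> tL x x' Xx Xx' M T.
have [S hS] := tL _ T (Xx' (- M%:Z) (2 * M).+1).
have [|d [[p hp] [q hq]]] := hS _ (Xx 0 S); first by rewrite size_block.
have ag r : occurs_at (block x' (- M%:Z) (2 * M).+1) r (block x 0 S) ->
    agree M x' (iter (r + M) (@left_shift _) x).
  move=> [a [b [E sza]]] k kM; rewrite iter_left_shift.
  have /(congr1 size) := E; rewrite !size_cat !size_block sza => szS.
  have := congr1 (fun s => nth false s (r + absz (k + M%:Z))) E.
  rewrite nth_block; last by lia.
  rewrite nth_cat ifF; last by rewrite sza; lia.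
  rewrite nth_cat ifT; last by rewrite size_block sza; lia.
  rewrite sza addKn nth_block; last by lia.
  move=> xx'; transitivity (x' (- M%:Z + (absz (k + M%:Z))%:Z)).
    by congr x'; lia.
  by rewrite -xx'; congr x; lia.
exists (p + M)%N, (q + M)%N, d => t tT.
by rewrite addnAC (addnAC q); split; apply: ag; [apply: hp|apply: hq].
Qed.


Lemma product_subsystem (A B : finType) (X : set (fullshift A))
  (Y : set (fullshift B)) : subshift X -> subshift Y ->
  subsystem (@prod_shift A B) (X `*` Y).
Proof.
move=> [cX sX] [cY sY]; split.
  move=> -[x y] cxy; split=> /=.
    apply: cX => U xU; have nU : nbhs (x, y) (U `*` setT).
      by exists (U, setT) => //; split=> //=; exact: filterT.
    by have [[x' y'] [[Xx' _] [Ux' _]]] := cxy _ nU; exists x'.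
  apply: cY => U yU; have nU : nbhs (x, y) (setT `*` U).
    by exists (setT, U) => //; split=> //=; exact: filterT.
  by have [[x' y'] [[_ Yy'] [_ Uy']]] := cxy _ nU; exists y'.
apply/seteqP; split=> [_ [[x y] [Xx Yy] <-]|[x y] [Xx Yy]].
  by split=> /=; [rewrite -sX|rewrite -sY]; [exists x|exists y].
move: Xx Yy => /=; rewrite -{1}sX -{1}sY => -[x' Xx' <-] [y' Yy' <-].
by exists (x', y').
Qed.

Section LimitSubshift.
Variables (R : realType) (i j : nat -> nat).
Hypothesis i0 : forall n, (0 < i n)%N.
Hypothesis ih : {homo i : m n / (m < n)%N}.
Hypothesis jh : {homo j : m n / (m < n)%N}.

Lemma stable_entropic_minimal_subshift :
  exists (A : finType) (X : set (fullshift A)),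
    [/\ subshift X, language_stable R X, (0 < topological_entropy R X)%E
      & minimal (@left_shift A) X] /\
    (forall N : nat, exists2 n : nat, (N <= n)%N &
      sft_cover X (i n) = sft_cover X (i n + j n)%N) /\
    (forall (alpha : R) (beta : nat -> R),
      irrational alpha ->
      (forall l, 0 < beta l < 1) ->
      forall l, minimal (@prod_shift A bool)
        (X `*` rotation_coding alpha (beta l))).
Proof.
have [L [[L0 fL] eL tL gL freeL]] := limit_language ih jh.
exists bool, (language_subshift L).
have LX : language (language_subshift L) = L.
  exact: language_language_subshift.
have sX := language_subshift_subshift L.
have visits := language_subshift_visits tL.
have gap N : exists2 n, (N <= n)%N & forall m, (i n < m <= i n + j n)%N ->
    min_forbidden (language_subshift L) m = set0.
  have [n Nn gn] := gL N; exists n => //; apply: min_forbidden_gap => //.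
  by rewrite LX.
split; [split=> //|split].
- exact: language_stable_gap gap.
- by apply: topological_entropy_free; rewrite LX.
- apply: minimal_orbits => // x' x Xx' Xx.
  have /choice[s sP] M : exists s, agree M x' (iter s (@left_shift _) x).
    have [p [q [d h]]] := visits x x' Xx Xx' M 0%N.
    by exists (p + 0 * d)%N; case: (h 0%N).
  by exists s; exact: agree_cvg.
- by move=> N; have [n Nn gn] := gap N; exists n => //; exact: sft_cover_eq.
move=> alpha beta ia b01 l.
apply: minimal_orbits.
  exact/product_subsystem/rotation_coding_subshift.
move=> [x' z'] [x z] [Xx' Zz'] [Xx Zz].
have /choice[s sP] M : exists s, agree M x' (iter s (@left_shift _) x) /\
    agree M z' (iter s (@left_shift _) z).
  (* The rotation dictates [T] first; progressions of that length in [x] then contain a common visit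
     time. *)
  have [T hT] := rotation_coding_visits (b01 l) M ia Zz Zz'.
  have [p [q [d h]]] := visits x x' Xx Xx' M T.
  have [t tT hz] := hT p q d; have [h1 h2] := h t tT.
  by case: hz => hz; [exists (p + t * d)%N|exists (q + t * d.+1)%N].
exists s.
have -> : (fun n => iter (s n) (@prod_shift bool bool) (x, z)) =
  (fun n => (iter (s n) (@left_shift _) x, iter (s n) (@left_shift _) z)).
  by apply/funext => n; rewrite iter_prod_shift.
have cx := agree_cvg (fun M => (sP M).1).
have cz := agree_cvg (fun M => (sP M).2).
exact: (@cvg_pair _ _ _ \oo (nbhs x') (nbhs z') _ _ _ _ _ cx cz).
Qed.

End LimitSubshift.

Theorem lemma6p5 (R : realType) :
  (exists (A : finType) (X : set (fullshift A)),
    [/\ subshift X, language_stable R X, (0 < topological_entropy R X)%E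
      & minimal (@left_shift A) X]) /\
  (forall i j : nat -> nat,
    (forall n, 0 < i n)%N ->
    {homo i : m n / (m < n)%N} ->
    {homo j : m n / (m < n)%N} ->
    exists (A : finType) (X : set (fullshift A)),
      [/\ subshift X, language_stable R X, (0 < topological_entropy R X)%E
        & minimal (@left_shift A) X] /\
      (forall N : nat, exists2 n : nat, (N <= n)%N &
        sft_cover X (i n) = sft_cover X (i n + j n)%N) /\
      (forall (alpha : R) (beta : nat -> R),
        irrational alpha ->
        (forall l, 0 < beta l < 1) ->
        forall l, minimal (@prod_shift A bool)
          (X `*` rotation_coding alpha (beta l)))).
Proof.
split; last exact: stable_entropic_minimal_subshift.
(* Any admissible intervals will do here. *)
have [] := @stable_entropic_minimal_subshift R succn id => //.
by move=> A [X [hX _]]; exists A, X.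
Qed.
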